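(* Let $d\ge4$ be even. There is a constant $C$, depending only on $d$, such that for every odd prime power $q$, every $j\in\mathbb{F}_q^*$ and every subset $E\subset S_j\subset\mathbb{F}_q^d$, $$\Lambda_4(E)=\sum_{\substack{(x,y,z,k)\in E^4\\ x+y=z+k}}1\ \le\ C\,\min\Big\{|E|^3,\ q^{-1}|E|^3+q^{\frac{d-2}{4}}|E|^{\frac52}+q^{\frac{3d-4}{4}}|E|^{\frac32}\Big\}.$$
   Context: $\mathbb{F}_q$ is the finite field with $q$ elements, $q$ a power of an odd prime, and $\mathbb{F}_q^*=\mathbb{F}_q\setminus\{0\}$. For $x\in\mathbb{F}_q^d$ put $\|x\|_2=x_1^2+\dots+x_d^2\in\mathbb{F}_q$, and for $j\in\mathbb{F}_q^*$ let $S_j=\{x\in\mathbb{F}_q^d:\|x\|_2=j\}$. $|E|$ denotes the number of elements of $E$. *)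

(* Defs.v *)
From HB Require Import structures.
From mathcomp Require Import all_boot all_order all_algebra.
From mathcomp Require Import reals exp.

Set Implicit Arguments.
Unset Strict Implicit.
Unset Printing Implicit Defensive.

Import Order.TTheory GRing.Theory Num.Theory.

Local Open Scope ring_scope.

(* An element of F, not a real norm: no square root is taken. *)
Definition norm2 (F : finFieldType) (d : nat) (x : 'rV[F]_d) : F :=
  \sum_(i < d) x 0 i ^+ 2.

Definition sphere (F : finFieldType) (d : nat) (j : F) : {set 'rV[F]_d} :=
  [set x | norm2 x == j].

Definition Lambda4 (F : finFieldType) (d : nat) (E : {set 'rV[F]_d}) : nat :=
  (\sum_(x in E) \sum_(y in E) \sum_(z in E)
     \sum_(k in E | (x + y == z + k)%R) 1)%N.

(* Main.v *)
Require Import Defs.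
From HB Require Import structures.
From mathcomp Require Import all_boot all_order all_algebra all_field.
From mathcomp Require Import reals exp ring lra.

Set Implicit Arguments.
Unset Strict Implicit.
Unset Printing Implicit Defensive.

Import Order.TTheory GRing.Theory Num.Theory.

Local Open Scope ring_scope.

(* If x, y, z and x + y - z lie on the sphere, then (x - z).(y - z) = 0, so
   Lambda_4(E) is at most the number of right-angled corners in E.  The sphere is
   the affine part of the cone Q = 0 for Q(v, t) = ||v|| - j t^2 on F^(d+1), and
   x |-> (x - z).(y - z) becomes a linear form on that space.  For fixed z the
   variance, over all points p of the cone, of the number of y in E whose form
   vanishes at p only involves the number of points of the cone on subspaces of
   codimension at most 2; as d + 1 is odd, this number is q^(d-2) + O(q^(d/2)) for
   any two independent forms, and exactly q^(d-2) if both are isotropic.  Passing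
   from the cone to the sphere gains a factor q - 1, because the counts are
   invariant under scaling.
   Dependent forms come from triples of E on a common line through z; besides the
   trivial ones these lie on isotropic lines, and there are at most q D of them,
   where D is the number of pairs of E with ||y - z|| = 0.  The exact count for
   isotropic forms, in the same variance argument, gives
   D <= |E|^2 / q + O(q^(d/2-1) |E|).  The remaining term q^(d/2-1) |E|^2 is
   dominated by |E|^3 / q + q^((3d-4)/4) |E|^(3/2). *)

(** * Linear equations over a finite field *)

Section Counting.

Variables (K : realFieldType) (F : finFieldType).
Let q : K := #|F|%:R.

Lemma card_field_gt0 : 0 < q.
Proof. by rewrite ltr0n; apply/card_gt0P; exists 0. Qed.

Lemma sumr1_card (T : finType) : \sum_(x : T) 1 = #|T|%:R :> K.
Proof. by rewrite sumr_const. Qed.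

Lemma sum_cst_card (T : finType) (c : K) : \sum_(x : T) c = #|T|%:R * c.
Proof. by rewrite sumr_const mulr_natl. Qed.

Lemma sum_eq1 (T : finType) (c : T) (G : T -> K) :
  \sum_x (x == c)%:R * G x = G c.
Proof.
rewrite (bigD1 c) //= eqxx mul1r big1 ?addr0 // => x /negPf ->.
by rewrite mul0r.
Qed.

Lemma sum_eq1_cst (T : finType) (c : T) (m : K) : \sum_x (x == c)%:R * m = m.
Proof. exact: (sum_eq1 c (fun=> m)). Qed.

(** This takes the place of orthogonality of additive characters: summing over s singles out b =
    0. *)
Lemma affine_zeros (a b : F) :
  \sum_s (a + s * b == 0)%:R
  = (b != 0)%:R + q * ((a == 0) && (b == 0))%:R :> K.
Proof.
case: eqVneq => [->|b0] /=.
  under eq_bigr => s _ do rewrite mulr0 addr0.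
  by rewrite sum_cst_card add0r andbT.
rewrite andbF mulr0 addr0 -[RHS](sum_eq1 (- a / b) (fun=> 1)).
apply: eq_bigr => s _; rewrite mulr1.
rewrite -[in RHS](inj_eq (mulIf b0)) divfK //. by rewrite -addr_eq0 [a + _]addrC.
Qed.

Lemma affine_zeros2 (f a b : F) :
  \sum_s \sum_t (f + s * a + t * b == 0)%:R
  = q ^+ 2 * [&& f == 0, a == 0 & b == 0]%:R
    + q * (1 - ((a == 0) && (b == 0))%:R) :> K.
Proof.
under eq_bigr => s _ do rewrite affine_zeros.
rewrite big_split /= sum_cst_card -/q; case: (b == 0) => /=.
  under eq_bigr => s _ do rewrite andbT.
  rewrite -mulr_sumr affine_zeros !andbT mulr0 add0r.
  by case: (a == 0); case: (f == 0) => /=; ring.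
under eq_bigr => s _ do rewrite andbF mulr0.
rewrite big1 // !andbF /= ?mulr1n ?mulr0n. ring.
Qed.

Variable V : finLmodType F.
Let v : K := #|V|%:R.

(** Every p has exactly one s for which L vanishes at p + s u, so averaging over the translations by
    multiples of u leaves v / q. *)
Lemma linear_form_zeros (L : V -> F) (u : V) :
  (forall p s, L (p + s *: u) = L p + s * L u) -> L u != 0 ->
  \sum_p (L p == 0)%:R = v / q :> K.
Proof.
move=> Llin Lu0; have q0 := lt0r_neq0 card_field_gt0.
apply: (mulIf q0); rewrite divfK // mulrC -sum_cst_card.
transitivity (\sum_(s : F) \sum_p (L p + s * L u == 0)%:R : K).
  apply: eq_bigr => s _; rewrite (reindex_inj (addIr (s *: u))) /=.
  by apply: eq_bigr => p _; rewrite Llin.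
rewrite exchange_big /= -[RHS]sumr1_card; apply: eq_bigr => p _.
by rewrite affine_zeros Lu0 (negPf Lu0) andbF mulr0 addr0.
Qed.

Variable B : V -> V -> F.
Hypothesis two_neq0 : 2 != 0 :> F.
Hypothesis B_lincomb : forall p s a t b,
  B p (s *: a + t *: b) = s * B p a + t * B p b.
Hypothesis B_sym : forall p a, B p a = B a p.
Hypothesis B_nondegenerate : forall a, a != 0 -> exists p, B p a != 0.

Lemma orth_card (a : V) : a != 0 -> \sum_p (B p a == 0)%:R = v / q :> K.
Proof.
move=> /B_nondegenerate[u ua].
apply: (@linear_form_zeros (B^~ a) u) => // p s.
rewrite B_sym -[in LHS](scale1r p) B_lincomb mul1r.
by rewrite B_sym [B a u]B_sym.
Qed.

Definition dependent (a b : V) :=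
  [exists s : F, exists t : F, ((s != 0) || (t != 0)) && (s *: a + t *: b == 0)].

(** Double count of the triples (p, s, t) with B p (s a + t b) = 0. By independence each (s, t)
    other than (0, 0) accounts for v / q points; sorted by p, the total is affine in the unknown
    count, with slope q^2 - q. *)
Lemma orth2_card (a b : V) : ~~ dependent a b ->
  \sum_p ((B p a == 0) && (B p b == 0))%:R = v / q ^+ 2 :> K.
Proof.
move=> indep; have q0 := lt0r_neq0 card_field_gt0.
have q20 : q ^+ 2 - q != 0.
  have -> : q ^+ 2 - q = q * (q - 1) by ring.
  rewrite mulf_neq0 // subr_eq0 pnatr_eq1.
  apply/eqP => q1.
  have /card_le1P : (#|F| <= 1)%N by rewrite q1.
  by move=> /(_ 0 isT) /(_ 1); rewrite !inE oner_eq0.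
have H : \sum_p \sum_s \sum_t (0 + s * B p a + t * B p b == 0)%:R
   = q * v + (v - v / q) :> K.
  rewrite exchange_big /=; under eq_bigr => s _ do rewrite exchange_big /=.
  transitivity (\sum_(s : F) \sum_(t : F)
     (v / q + (s == 0)%:R * ((t == 0)%:R * (v - v / q)))).
    apply: eq_bigr => s _; apply: eq_bigr => t _.
    under eq_bigr => p _ do rewrite add0r -B_lincomb.
    have [st0|ab0] := eqVneq (s *: a + t *: b) 0; last first.
      rewrite orth_card //.
      have [s0|_] := eqVneq s 0; last by rewrite mul0r addr0.
      have [t0|_] := eqVneq t 0; last by rewrite mul0r mulr0 addr0.
      by rewrite s0 t0 !scale0r addr0 eqxx in ab0.
    have [s0|s0] := eqVneq s 0; last first.
      case/negP: indep; apply/existsP; exists s; apply/existsP; exists t.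
      by rewrite s0 st0 /=.
    have [t0|t0] := eqVneq t 0; last first.
      case/negP: indep; apply/existsP; exists s; apply/existsP; exists t.
      by rewrite t0 orbT st0 /=.
    rewrite st0 !mul1r [RHS]addrC subrK /v -[RHS]sumr1_card; apply: eq_bigr => p _.
    have := B_lincomb p 0 a 0 a; rewrite !scale0r addr0 !mul0r addr0 => ->.
    by rewrite eqxx.
  under eq_bigr => s _ do
    rewrite big_split /= sum_cst_card -mulr_sumr sum_eq1_cst -/q.
  rewrite big_split /= sum_eq1_cst sum_cst_card -/q.
  by congr (_ + _); field.
move: H; under eq_bigr => p _ do rewrite affine_zeros2 eqxx /=.
rewrite big_split /= -!mulr_sumr sumrB /= sumr1_card -/v.
set k := \sum_p _ => H.
apply: (mulfI q20).
rewrite -/k in H *.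
have -> : (q ^+ 2 - q) * k = q ^+ 2 * k + q * (v - k) - q * v by ring.
rewrite H; by field.
Qed.

(** * Points of a quadric on subspaces of codimension one and two *)

Lemma form_addsq (p c : V) : B (p + c) (p + c) = B p p + 2 * B p c + B c c.
Proof.
have BD x y z : B x (y + z) = B x y + B x z.
  by have := B_lincomb x 1 y 1 z; rewrite !scale1r !mul1r.
by rewrite BD B_sym BD [B (p + c) c]B_sym BD [B c p]B_sym; ring.
Qed.

Lemma sum_quadric (r : pred V) :
  \sum_(p | B p p == 0) (r p)%:R = \sum_p ((B p p == 0) && r p)%:R :> K.
Proof.
by rewrite big_mkcond; apply: eq_bigr => p _; case: (B p p == 0).
Qed.

Let level (c : F) : K := \sum_p (B p p == c)%:R.

Lemma sum_level : \sum_c level c = v.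
Proof.
rewrite exchange_big /= -[RHS]sumr1_card; apply: eq_bigr => p _.
under eq_bigr => c _ do rewrite eq_sym -[_%:R]mulr1.
exact: sum_eq1_cst.
Qed.

(* Completing the square: it turns the linear constraints into translates of the
   quadric, so that only the sizes of the level sets of the form are needed. *)
Lemma level_shift (c : V) :
  \sum_p (B p p + 2 * B p c == 0)%:R = level (B c c).
Proof.
rewrite /level [RHS](reindex_inj (addIr c)) /=; apply: eq_bigr => p _.
by rewrite form_addsq -[in RHS]subr_eq0 addrK.
Qed.

(** By [level_shift] the sum over s counts the pairs (p, s) with B p p + 2 s B p a = 0. A point with
    B p a != 0 has exactly one s; one with B p a = 0 has all s or none, according to whether it lies
    on the quadric. *)
Lemma quadric_orth_level (a : V) : a != 0 ->
  q * \sum_(p | B p p == 0) (B p a == 0)%:R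
  = \sum_(s : F) level (B (s *: a) (s *: a)) - v + v / q.
Proof.
move=> a0; under [in RHS]eq_bigr => s _ do rewrite -level_shift.
rewrite exchange_big /=.
have -> : \sum_p \sum_s (B p p + 2 * B p (s *: a) == 0)%:R
   = \sum_p ((1 - (B p a == 0)%:R) + q * ((B p p == 0) && (B p a == 0))%:R) :> K.
  apply: eq_bigr => p _.
  have E s : B p (s *: a) = s * B p a.
    by have := B_lincomb p s a 0 a; rewrite scale0r addr0 mul0r addr0.
  under eq_bigr => s _ do rewrite E mulrCA.
  rewrite affine_zeros mulf_eq0 (negPf two_neq0) /=.
  by case: (B p a == 0) => /=; rewrite ?subrr ?subr0.
rewrite big_split /= sumrB sumr1_card orth_card // -mulr_sumr -sum_quadric -/v.
by ring.
Qed.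

(** The same count with the translates by all s a + t b. *)
Lemma quadric_orth2_level (a b : V) : ~~ dependent a b ->
  q ^+ 2 * \sum_(p | B p p == 0) ((B p a == 0) && (B p b == 0))%:R
  = \sum_(s : F) \sum_(t : F) level (B (s *: a + t *: b) (s *: a + t *: b))
    - q * v + v / q.
Proof.
move=> indep; have q0 := lt0r_neq0 card_field_gt0.
under [in RHS]eq_bigr => s _.
  by under eq_bigr => t _ do rewrite -level_shift; rewrite exchange_big over.
rewrite exchange_big /=.
have -> : \sum_p \sum_s \sum_t (B p p + 2 * B p (s *: a + t *: b) == 0)%:R
   = \sum_p (q ^+ 2 * ((B p p == 0) && ((B p a == 0) && (B p b == 0)))%:R
    + q * (1 - ((B p a == 0) && (B p b == 0))%:R)) :> K.
  apply: eq_bigr => p _.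
  under eq_bigr => s _ do under eq_bigr => t _ do
    rewrite B_lincomb mulrDr mulrCA [2 * (t * _)]mulrCA addrA.
  by rewrite affine_zeros2 !mulf_eq0 (negPf two_neq0).
rewrite big_split /= -!mulr_sumr sumrB sumr1_card orth2_card // -/v -sum_quadric.
by field.
Qed.

Section GeneralPosition.

Variable e : K.
Hypothesis level_dist : forall c, `|level c - v / q| <= e.

(** By [quadric_orth_level] the deviation is the mean over s of the deviations of q level sizes, so
    it inherits the bound e without loss. *)
Lemma quadric_orth_dist (a : V) : a != 0 ->
  `|\sum_(p | B p p == 0) (B p a == 0)%:R - v / q / q| <= e.
Proof.
move=> a0; have q_gt0 := card_field_gt0; have q0 := lt0r_neq0 q_gt0.
rewrite -(ler_pM2l q_gt0) -{1}(gtr0_norm q_gt0) -normrM mulrBr.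
rewrite quadric_orth_level //.
set S := \sum_s _.
have -> : S - v + v / q - q * (v / q / q) = S - q * (v / q) by field.
rewrite -[q * (v / q)]sum_cst_card -[q * e]sum_cst_card -sumrB.
by apply: le_trans (ler_norm_sum _ _ _) _; apply: ler_sum.
Qed.

Lemma quadric_orth2_dist (a b : V) : ~~ dependent a b ->
  `|\sum_(p | B p p == 0) ((B p a == 0) && (B p b == 0))%:R - v / q / q / q| <= e.
Proof.
move=> indep; have q_gt0 := card_field_gt0; have q0 := lt0r_neq0 q_gt0.
have q2_gt0 : 0 < q ^+ 2 by rewrite exprn_gt0.
rewrite -(ler_pM2l q2_gt0) -{1}(gtr0_norm q2_gt0) -normrM mulrBr.
rewrite quadric_orth2_level //.
set S := \sum_s _.
have -> : S - q * v + v / q - q ^+ 2 * (v / q / q / q) = S - q * (q * (v / q)).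
  by field.
rewrite -[q * (v / q)]sum_cst_card -[q * \sum_i _]sum_cst_card.
rewrite expr2 -mulrA -[q * e]sum_cst_card -[q * \sum_i _]sum_cst_card -sumrB.
apply: le_trans (ler_norm_sum _ _ _) _; apply: ler_sum => s _.
rewrite -sumrB; apply: le_trans (ler_norm_sum _ _ _) _; exact: ler_sum.
Qed.

End GeneralPosition.

Section Isotropic.

Hypothesis level0 : level 0 = v / q.

Lemma quadric_orth_isotropic (a : V) : a != 0 -> B a a = 0 ->
  \sum_(p | B p p == 0) (B p a == 0)%:R = v / q / q :> K.
Proof.
move=> a0 aa; have q0 := lt0r_neq0 card_field_gt0.
apply: (mulfI q0); rewrite quadric_orth_level //.
under eq_bigr => s _.
  have -> : B (s *: a) (s *: a) = 0.
    have E p : B p (s *: a) = s * B p a.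
      by have := B_lincomb p s a 0 a; rewrite scale0r addr0 mul0r addr0.
    by rewrite E B_sym E aa !mulr0.
  rewrite level0; over.
by rewrite sum_cst_card -/q; field.
Qed.

(** On the span of a and b the form is 2 s t B a b. For fixed s this is either zero for all t or
    runs once through F as t does; the level sizes add up to v in both cases, by [level0] and by
    [sum_level] respectively. *)
Lemma quadric_orth2_isotropic (a b : V) : ~~ dependent a b ->
  B a a = 0 -> B b b = 0 ->
  \sum_(p | B p p == 0) ((B p a == 0) && (B p b == 0))%:R = v / q / q / q :> K.
Proof.
move=> indep aa bb; have q0 := lt0r_neq0 card_field_gt0.
apply: (mulfI (expf_neq0 2 q0)); rewrite quadric_orth2_level //.
under eq_bigr => s _.
  have -> : \sum_(t : F) level (B (s *: a + t *: b) (s *: a + t *: b)) = v.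
    under eq_bigr => t _.
      have -> : B (s *: a + t *: b) (s *: a + t *: b) = (2 * s * B a b) * t.
        rewrite B_lincomb [B _ a]B_sym [B (_ + _) b]B_sym !B_lincomb aa bb.
        by rewrite [B b a]B_sym; ring.
      over.
    have [->|k0] := eqVneq (2 * s * B a b) 0.
      under eq_bigr => t _ do rewrite mul0r level0.
      by rewrite sum_cst_card -/q; field.
    by rewrite -sum_level [RHS](reindex_inj (mulfI k0)).
  over.
by rewrite sum_cst_card -/q; field.
Qed.

End Isotropic.

End Counting.

(** * Cauchy-Schwarz and a second moment inequality *)

Lemma sum_sqr_cauchy (K : realFieldType) (I : finType) (A : {pred I}) (f : I -> K) :
  (\sum_(i in A) f i) ^+ 2 <= #|A|%:R * \sum_(i in A) f i ^+ 2.
Proof.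
have : 0 <= \sum_(i in A) \sum_(j in A) (f i - f j) ^+ 2.
  by apply: sumr_ge0 => i _; apply: sumr_ge0 => j _; apply: sqr_ge0.
set S := \sum_(i in A) f i; set T := \sum_(i in A) f i ^+ 2.
suff -> : \sum_(i in A) \sum_(j in A) (f i - f j) ^+ 2
          = 2 * (#|A|%:R * T) - 2 * S ^+ 2 by lra.
transitivity (\sum_(i in A) (#|A|%:R * f i ^+ 2 + T - 2 * S * f i)).
  apply: eq_bigr => i _.
  have -> : 2 * S * f i = \sum_(j in A) 2 * f i * f j.
    by rewrite -mulr_sumr -/S; ring.
  rewrite mulr_natl -sumr_const -big_split -sumrB /=.
  by apply: eq_bigr => j _; ring.
rewrite sumrB big_split /= sumr_const -!mulr_sumr -/S -/T -mulr_natl.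
by ring.
Qed.

(** When the square is expanded the main terms m^2 w / q^2 cancel. Pairs in [D] are charged the
    whole count w / q + e of one of their members. The factor 3 is one e from the joint counts and
    two from the cross term. *)
Lemma variance_bound (K : realFieldType) (X I : finType) (W : pred X)
    (A : {set I}) (r : I -> X -> bool) (D : rel I) (q w e : K) :
  1 <= q -> 0 <= e -> 0 <= w -> \sum_(x | W x) 1 = w ->
  {in A, forall y, `|\sum_(x | W x) (r y x)%:R - w / q| <= e} ->
  {in A &, forall y z, ~~ D y z ->
     \sum_(x | W x) (r y x && r z x)%:R <= w / q / q + e} ->
  \sum_(x | W x) (\sum_(y in A) (r y x)%:R - #|A|%:R / q) ^+ 2
  <= 3 * e * #|A|%:R ^+ 2
     + (w / q + e) * \sum_(y in A) \sum_(z in A) (D y z)%:R.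
Proof.
move=> q1 e0 w0 Wsum r1 r2; set m : K := #|A|%:R.
have qpos : 0 < q by lra.
have m0 : 0 <= m by rewrite ler0n.
have -> : \sum_(x | W x) (\sum_(y in A) (r y x)%:R - m / q) ^+ 2
    = \sum_(y in A) \sum_(z in A) \sum_(x | W x) (r y x && r z x)%:R
      - 2 * (m / q) * \sum_(y in A) \sum_(x | W x) (r y x)%:R
      + (m / q) ^+ 2 * w.
  transitivity (\sum_(x | W x) (\sum_(y in A) \sum_(z in A) (r y x && r z x)%:R
     - 2 * (m / q) * (\sum_(y in A) (r y x)%:R) + (m / q) ^+ 2 * 1)).
    apply: eq_bigr => x _.
    have -> : \sum_(y in A) \sum_(z in A) (r y x && r z x)%:R
       = (\sum_(y in A) (r y x)%:R) * (\sum_(y in A) (r y x)%:R) :> K.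
      rewrite mulr_suml; apply: eq_bigr => y _; rewrite mulr_sumr.
      by apply: eq_bigr => z _; rewrite -natrM mulnb.
    by ring.
  rewrite big_split /= sumrB -!mulr_sumr Wsum; congr (_ - _ * _ + _).
    rewrite exchange_big /=; apply: eq_bigr => y _; exact: exchange_big.
  exact: exchange_big.
have H2 : \sum_(y in A) \sum_(z in A) \sum_(x | W x) (r y x && r z x)%:R
   <= m ^+ 2 * (w / q / q + e)
      + (w / q + e) * \sum_(y in A) \sum_(z in A) (D y z)%:R.
  have -> : m ^+ 2 * (w / q / q + e) = \sum_(y in A) \sum_(z in A) (w / q / q + e).
    by rewrite !sumr_const -/m -mulr_natl -[_ *+ #|A|]mulr_natl -/m; ring.
  rewrite mulr_sumr -big_split /=; apply: ler_sum => y Ay.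
  rewrite mulr_sumr -big_split /=; apply: ler_sum => z Az.
  case: (boolP (D y z)) => [_|nD]; last by rewrite mulr0 addr0; exact: r2.
  rewrite mulr1; apply: (@le_trans _ _ (\sum_(x | W x) (r y x)%:R)).
    by apply: ler_sum => x _; rewrite ler_nat; case: (r y x); case: (r z x).
  have := r1 y Ay; rewrite ler_norml => /andP[_].
  have : 0 <= w / q / q by rewrite !divr_ge0 // ltW.
  by lra.
have H1 : m * (w / q - e) <= \sum_(y in A) \sum_(x | W x) (r y x)%:R.
  rewrite /m mulr_natl -sumr_const; apply: ler_sum => y Ay.
  by have := r1 y Ay; rewrite ler_norml => /andP[]; lra.
have H1' : 2 * (m / q) * (m * (w / q - e)) <=
   2 * (m / q) * \sum_(y in A) \sum_(x | W x) (r y x)%:R.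
  by apply: ler_wpM2l => //; rewrite mulr_ge0 // divr_ge0 // ltW.
have H3 : 2 * (m / q) * m * e <= 2 * e * m ^+ 2.
  have -> : 2 * (m / q) * m * e = (2 * e * m ^+ 2) * q^-1 by ring.
  rewrite ler_piMr ?invf_le1 //.
  by rewrite mulr_ge0 ?sqr_ge0 // mulr_ge0.
have E : m ^+ 2 * (w / q / q) - 2 * (m / q) * (m * (w / q)) + (m / q) ^+ 2 * w = 0.
  by field; rewrite lt0r_neq0.
by nra.
Qed.

(** * Numbers of representations by sums of squares *)

Section SumsOfSquares.

Variables (K : realFieldType) (F : finFieldType).
Hypothesis F_odd : odd #|F|.
Let q : K := #|F|%:R.

Lemma two_neq0_odd : 2 != 0 :> F.
Proof.
apply/eqP => two0.
have char2 : 2 \in [pchar F] by rewrite inE /= two0 eqxx.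
have := card_pprimeChar char2; have := finNzRing_gt1 F.
case: (logn 2 #|F|) => [|n] gt1 cardF; first by rewrite cardF in gt1.
by move: F_odd; rewrite cardF oddX.
Qed.

(** Pigeonhole: squaring is at most two-to-one and the order of F is odd, so the squares, and
    likewise the elements c - a^2, make up more than half of F. The two sets meet. *)
Lemma sum_two_squares (c : F) : exists a b : F, a ^+ 2 + b ^+ 2 = c.
Proof.
pose A := [set x ^+ 2 | x : F]; pose B := [set c - a | a in A].
have cardF : (#|F| <= 2 * #|A|)%N.
  rewrite -[leqLHS]sum1_card (partition_big (fun x : F => x ^+ 2) (mem A)) /=; last first.
    by move=> x _; apply: imset_f.
  rewrite mulnC -sum_nat_const; apply: leq_sum => _ /imsetP[y _ ->].
  rewrite sum1_card; apply: leq_trans (_ : #|[set y; - y]| <= 2)%N.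
    apply: subset_leq_card; apply/subsetP => x.
    by rewrite !inE -eqf_sqr.
  by rewrite cards2; case: (_ == _).
have cardB : #|B| = #|A| by rewrite card_imset //; apply: subrI.
have : A :&: B != set0.
  apply/negP => /eqP AB0.
  have := max_card (mem (A :|: B)); rewrite cardsU AB0 cards0 subn0 cardB.
  rewrite addnn -mul2n => leF.
  have FA : #|F| = (2 * #|A|)%N by apply/eqP; rewrite eqn_leq cardF leF.
  by move: F_odd; rewrite FA mul2n odd_double.
case/set0Pn => x /setIP[/imsetP[a _ ->]] /imsetP[_ /imsetP[b _ ->] E].
by exists a, b; rewrite E subrK.
Qed.

Definition pairsum (e : F) : K :=
  \sum_(p : F * F) (p.1 ^+ 2 + p.2 ^+ 2 == e)%:R.

Lemma sum_pairsum : \sum_e pairsum e = q ^+ 2.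
Proof.
rewrite exchange_big /= (eq_bigr (fun=> 1)) => [|p _].
  by rewrite sum_cst_card card_prod natrM mulr1.
under eq_bigr => c _ do rewrite eq_sym -[_%:R]mulr1.
exact: sum_eq1_cst.
Qed.

Lemma pairsum_scale (e f : F) : e != 0 -> f != 0 -> pairsum e = pairsum f.
Proof.
move=> e0 f0; have [a [b ab]] := sum_two_squares (e / f).
have ab0 : a ^+ 2 + b ^+ 2 != 0 by rewrite ab mulf_neq0 ?invr_eq0.
(* multiplication by a + ib *)
pose g (p : F * F) := (a * p.1 - b * p.2, b * p.1 + a * p.2).
have g_inj : injective g.
  move=> [s t] [s' t'] [/= E1 E2].
  have Es : (a ^+ 2 + b ^+ 2) * s = (a ^+ 2 + b ^+ 2) * s'.
    transitivity (a * (a * s - b * t) + b * (b * s + a * t)); first by ring.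
    by rewrite E1 E2; ring.
  have Et : (a ^+ 2 + b ^+ 2) * t = (a ^+ 2 + b ^+ 2) * t'.
    transitivity (a * (b * s + a * t) - b * (a * s - b * t)); first by ring.
    by rewrite E1 E2; ring.
  by rewrite (mulfI ab0 Es) (mulfI ab0 Et).
rewrite /pairsum (reindex_inj g_inj) /=; apply: eq_bigr => -[s t] _ /=.
have -> : (a * s - b * t) ^+ 2 + (b * s + a * t) ^+ 2
        = (a ^+ 2 + b ^+ 2) * (s ^+ 2 + t ^+ 2) by ring.
rewrite -[e](mulfVK f0) ab; congr (_%:R).
by rewrite (inj_eq (mulfI _)) // mulf_neq0 ?invr_eq0.
Qed.

(** By [pairsum_scale] all nonzero values are represented equally often, so the total q^2 and
    [pairsum 0] determine everything. The sign [eps] tells whether -1 is a square. *)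
Lemma pairsumE : exists eps : K, eps ^+ 2 = 1 /\
  forall e, pairsum e = q + eps * (q * (e == 0)%:R - 1).
Proof.
have q_gt1 : 1 < q.
  have := finNzRing_gt1 F; by rewrite ltr1n.
suff [eps [eps2 M0]] : exists eps : K, eps ^+ 2 = 1 /\ pairsum 0 = q + eps * (q - 1).
  exists eps; split=> // e; have [->|e0] := eqVneq e 0; first by rewrite M0 mulr1.
  have := sum_pairsum; rewrite (bigD1 0) //= M0.
  under eq_bigr => f f0 do rewrite (pairsum_scale f0 e0).
  have -> : \sum_(i : F | i != 0) pairsum e = (q - 1) * pairsum e.
    have := sum_cst_card F (pairsum e); rewrite (bigD1 (0:F)) //= -/q => H.
    by rewrite mulrBl mul1r -H addrAC subrr add0r.
  move=> H; apply: (@mulfI _ (q - 1)); first by rewrite subr_eq0 gt_eqF.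
  have -> : (q - 1) * pairsum e = q ^+ 2 - (q + eps * (q - 1)) by rewrite -H; ring.
  by ring.
(* Without a square root of -1 only (0, 0) represents 0. With a root i, the change of variables [g]
   factors s^2 + t^2, and 2 q - 1 pairs have product 0. *)
case: (pickP (fun i : F => i ^+ 2 == -1)) => [i /eqP i2|no_i]; last first.
  exists (-1); split; first by ring.
  rewrite /pairsum (bigD1 (0, 0)) //= expr0n addr0 eqxx /= mulr1n.
  rewrite big1 ?addr0; first by ring.
  case=> s t /= st0; case: eqP => // st.
  have [t0|t0] := eqVneq t 0.
    move: st st0; rewrite t0 expr0n addr0 => /eqP; rewrite expf_eq0 => /= /eqP ->.
    by rewrite eqxx.
  have /negP[] := negbT (no_i (s / t)).
  by rewrite expr_div_n -(inj_eq (mulIf (expf_neq0 2 t0))) divfK ?expf_neq0 //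
     mulN1r -addr_eq0 st.
exists 1; split; first by rewrite expr1n.
pose g (p : F * F) := (p.1 + i * p.2, p.1 - i * p.2).
have i0 : i != 0.
  by apply/eqP => i0; move/eqP: i2; rewrite i0 expr0n eq_sym oppr_eq0 oner_eq0.
have g_inj : injective g.
  move=> [s t] [s' t'] [/= E1 E2].
  have /(mulfI two_neq0_odd) -> : 2 * s = 2 * s'.
    transitivity ((s + i * t) + (s - i * t)); first by ring.
    by rewrite E1 E2; ring.
  have ti0 : 2 * i != 0 by rewrite mulf_neq0 // two_neq0_odd.
  suff /(mulfI ti0) -> : 2 * i * t = 2 * i * t' by [].
  transitivity ((s + i * t) - (s - i * t)); first by ring.
  by rewrite E1 E2; ring.
transitivity (\sum_(p : F * F) (p.1 * p.2 == 0)%:R : K).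
  rewrite [RHS](reindex_inj g_inj); apply: eq_bigr => -[s t] _ /=.
  suff -> : (s + i * t) * (s - i * t) = s ^+ 2 + t ^+ 2 by [].
  have -> : t ^+ 2 = - (i ^+ 2 * t ^+ 2) by rewrite i2 mulN1r opprK.
  by ring.
rewrite -(pair_bigA _ (fun s t : F => (s * t == 0)%:R : K)) /=.
transitivity (\sum_(s : F) ((1 - (s == 0)%:R * 1) + (s == 0)%:R * q) : K).
  apply: eq_bigr => s _; under eq_bigr => t _ do rewrite -[s * t]add0r [s * t]mulrC.
  rewrite affine_zeros eqxx /= -/q.
  by case: (s == 0) => /=; ring.
by rewrite big_split /= sumrB !sum_eq1_cst sumr1_card -/q; ring.
Qed.

Lemma pairsum_norm2 (G : F -> K) :
  \sum_(x : 'rV[F]_2) G (norm2 x) = \sum_e pairsum e * G e.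
Proof.
transitivity (\sum_(p : F * F) G (p.1 ^+ 2 + p.2 ^+ 2)).
  pose h (p : F * F) : 'rV[F]_2 := \row_i (if i == 0 then p.1 else p.2).
  pose h' (x : 'rV[F]_2) := (x 0 0, x 0 1).
  rewrite (reindex h) /=.
    apply: eq_bigr => p _; rewrite /norm2 !big_ord_recl big_ord0 addr0 !mxE.
    by [].
  exists h' => [p _|x _]; first by rewrite /h' !mxE; case: p.
  apply/rowP => i; rewrite mxE; case: eqP => [->|/eqP i0] //=.
  congr (x 0 _); apply/val_inj; case: i i0 => -[|[|]] //.
under [RHS]eq_bigr => e _ do rewrite mulr_suml.
rewrite exchange_big /=; apply: eq_bigr => p _.
rewrite -[LHS](sum_eq1 _ G); apply: eq_bigr => e _.
by rewrite eq_sym.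
Qed.

Lemma norm2_row_mx (m n : nat) (x : 'rV[F]_m) (y : 'rV[F]_n) :
  norm2 (row_mx x y) = norm2 x + norm2 y.
Proof.
rewrite /norm2 big_split_ord /=; congr (_ + _); apply: eq_bigr => i _.
  by rewrite row_mxEl.
by rewrite row_mxEr.
Qed.

Lemma sum_row_mx (m n : nat) (G : 'rV[F]_(m + n) -> K) :
  \sum_x G x = \sum_x \sum_y G (row_mx x y).
Proof.
rewrite pair_bigA /= (reindex (fun p : 'rV_m * 'rV_n => row_mx p.1 p.2)) //.
exists (fun x => (lsubmx x, rsubmx x)) => [[x y] _|x _] /=.
  by rewrite row_mxKl row_mxKr.
exact: hsubmxK.
Qed.

(** Induction on h, splitting off two coordinates and convolving with [pairsumE]. The sign [eps] is
    the same for all c; the factor q on the left avoids the power q^(h-1) at h = 0. *)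
Lemma norm2_levels (h : nat) : exists eps : K, eps ^+ 2 = 1 /\
  forall c, q * \sum_(x : 'rV[F]_(h.*2)) (norm2 x == c)%:R
    = q ^+ (h.*2) + eps * q ^+ h * (q * (c == 0)%:R - 1).
Proof.
elim: h => [|h [eps [eps2 IH]]].
  exists 1; split=> [|c]; first by rewrite expr1n.
  rewrite (eq_bigr (fun=> (c == 0)%:R)) => [|x _].
    by rewrite sum_cst_card card_mx expn0 !expr0; ring.
  by rewrite /norm2 big_ord0 eq_sym.
have [eps' [eps'2 H2]] := pairsumE.
exists (eps' * eps); split=> [|c]; first by rewrite exprMn eps2 eps'2 mulr1.
rewrite (@sum_row_mx 2 h.*2).
transitivity (\sum_(x : 'rV[F]_2)
  (q ^+ (h.*2) + eps * q ^+ h * (q * (c - norm2 x == 0)%:R - 1))).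
  rewrite mulr_sumr; apply: eq_bigr => x _; rewrite -IH; congr (_ * _).
  apply: eq_bigr => y _; rewrite (@norm2_row_mx 2 h.*2) addrC.
  by rewrite [in RHS]eq_sym subr_eq eq_sym.
rewrite (@pairsum_norm2 (fun e =>
  q ^+ (h.*2) + eps * q ^+ h * (q * (c - e == 0)%:R - 1))).
set A := q ^+ h.*2; set B := eps * q ^+ h; set k : K := (c == 0)%:R.
(* Expansion in the indicators of e = 0 and e = c, whose product is [k] times the first. *)
transitivity (\sum_(e : F) ((q * A - q * B - eps' * A + eps' * B)
  + (e == 0)%:R * (eps' * q * A - eps' * q * B + k * (eps' * q ^+ 2 * B))
  + (e == c)%:R * (q ^+ 2 * B - eps' * q * B))).
  apply: eq_bigr => e _; rewrite H2 subr_eq0 [c == e]eq_sym /k.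
  have [->|_] := eqVneq e 0; last by case: (e == c) => /=; ring.
  by rewrite eq_sym; case: (c == 0) => /=; ring.
rewrite 2!big_split /= !sum_eq1_cst sum_cst_card -/q doubleS !exprS.
by rewrite /B -/A; ring.
Qed.

End SumsOfSquares.

HB.instance Definition _ (F : finFieldType) (U V : finLmodType F) :=
  GRing.Lmodule.on (U * V)%type.

(** * The dot product on F^d *)

Section DotProduct.

Variables (F : finFieldType) (d : nat).
Implicit Types x y z : 'rV[F]_d.

Definition dot x y : F := \sum_i x 0 i * y 0 i.

Lemma dotC x y : dot x y = dot y x.
Proof. by apply: eq_bigr => i _; rewrite mulrC. Qed.

Lemma dotDr x y z : dot x (y + z) = dot x y + dot x z.
Proof. by rewrite -big_split; apply: eq_bigr => i _; rewrite mxE mulrDr. Qed.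

Lemma dotZr s x y : dot x (s *: y) = s * dot x y.
Proof. by rewrite /dot mulr_sumr; apply: eq_bigr => i _; rewrite mxE mulrCA. Qed.

Lemma dotDl x y z : dot (x + y) z = dot x z + dot y z.
Proof. by rewrite dotC dotDr !(dotC z). Qed.

Lemma dotZl s x y : dot (s *: x) y = s * dot x y.
Proof. by rewrite dotC dotZr dotC. Qed.

Lemma dotNr x y : dot x (- y) = - dot x y.
Proof. by rewrite -scaleN1r dotZr mulN1r. Qed.

Lemma dotNl x y : dot (- x) y = - dot x y.
Proof. by rewrite dotC dotNr dotC. Qed.

Definition dotE := (dotDl, dotDr, dotNl, dotNr, dotZl, dotZr).

Lemma norm2_dot x : norm2 x = dot x x.
Proof. by apply: eq_bigr => i _; rewrite expr2. Qed.

Lemma dot_nondegenerate x : x != 0 -> exists y, dot y x != 0.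
Proof.
case/rV0Pn => i xi; exists (delta_mx 0 i).
rewrite /dot (bigD1 i) //= big1 => [|k ki]; first by rewrite mxE !eqxx mul1r addr0.
by rewrite mxE (negPf ki) andbF mul0r.
Qed.

End DotProduct.

(* [F^o] rather than [F], so that the pair type is a module over [F]. *)
Definition hspace (F : finFieldType) (d : nat) : finLmodType F :=
  ('rV[F]_d * F^o)%type.

(** * The quadratic form of the cone over the sphere *)

Section Homogenisation.

Variables (K : realFieldType) (F : finFieldType) (d : nat) (j : F).
Hypothesis j_neq0 : j != 0.
Let q : K := #|F|%:R.
Let V := hspace F d.

(** The symmetric bilinear form of Q(v, t) = ||v|| - j t^2: x lies on the sphere exactly when (x, 1)
    is isotropic. *)
Definition hform (p a : V) : F := dot p.1 a.1 - j * p.2 * a.2.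

Lemma hform_lincomb p s a t b :
  hform p (s *: a + t *: b) = s * hform p a + t * hform p b.
Proof.
rewrite /hform /= !dotE.
have -> : s *: a.2 = s * (a.2 : F) by [].
have -> : t *: b.2 = t * (b.2 : F) by [].
by ring.
Qed.

Lemma hformC p a : hform p a = hform a p.
Proof. by rewrite /hform dotC mulrAC. Qed.

Lemma hform_scale_eq0 s p a : s != 0 -> (hform (s *: p) a == 0) = (hform p a == 0).
Proof.
move=> s0; rewrite hformC -[s *: p]addr0 -(scale0r 0) hform_lincomb mul0r addr0.
by rewrite mulf_eq0 (negPf s0) hformC.
Qed.

Lemma hform_nondegenerate a : a != 0 -> exists p, hform p a != 0.
Proof.
case: a => x t /= a0; have [x0|x0] := eqVneq x 0.
  exists (0, 1); rewrite /hform /= x0 dotC -(scale0r 0) dotZl mul0r.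
  rewrite mulr1 sub0r oppr_eq0 mulf_neq0 //.
  by apply: contraNneq a0 => t0; rewrite x0 t0.
have [y xy] := dot_nondegenerate x0.
by exists (y, 0); rewrite /hform /= mulr0 mul0r subr0.
Qed.

Lemma card_hspace : #|V|%:R / q = q ^+ d.
Proof.
by rewrite card_prod card_mx mul1n natrM natrX mulfK // lt0r_neq0 ?card_field_gt0.
Qed.

Lemma square_roots_le (c : F) : \sum_(t : F) (c + j * t ^+ 2 == 0)%:R <= 2 :> K.
Proof.
rewrite -natr_sum ler_nat.
rewrite -[leqLHS](eq_bigl _ _ (fun=> erefl)) -big_mkcond /= sum1_card.
case: (pickP (fun t : F => c + j * t ^+ 2 == 0)) => [t0 t0P|none]; last first.
  by rewrite eq_card0 // => t; rewrite unfold_in none.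
apply: leq_trans (_ : #|[set t0; - t0]| <= 2)%N; last by rewrite cards2; case: (_ == _).
apply: subset_leq_card; apply/subsetP => t; rewrite unfold_in => tP.
rewrite !inE -eqf_sqr -(inj_eq (mulfI j_neq0)) -(inj_eq (addrI c)).
by rewrite (eqP t0P).
Qed.

(** For each of the q - 1 values t != 0 the slice of the cone at height t contains t E, where G
    takes the values G (x, 1) by homogeneity. The slice t = 0 only adds nonnegative terms. *)
Lemma cone_sum_ge (E : {set 'rV[F]_d}) (G : V -> K) :
  E \subset sphere d j -> (forall p, 0 <= G p) ->
  (forall s p, s != 0 -> G (s *: p) = G p) ->
  (q - 1) * \sum_(x in E) G (x, 1) <= \sum_(p | hform p p == 0) G p.
Proof.
move=> /subsetP ES G0 Ghom.
have -> : \sum_(p | hform p p == 0) G p = \sum_(t : F^o) \sum_(x : 'rV[F]_d)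
    (if hform (x, t) (x, t) == 0 then G (x, t) else 0).
  by rewrite exchange_big pair_bigA big_mkcond; apply: eq_bigr => -[x t].
rewrite (bigD1 (0 : F^o)) //=.
apply: (@le_trans _ _ (\sum_(t : F | t != 0) \sum_(x in E) G (x, 1))).
  set S := \sum_(x in E) _.
  have := sum_cst_card F S; rewrite (bigD1 (0 : F)) //= -/q => H.
  by rewrite mulrBl mul1r -H addrAC subrr add0r.
apply: ler_wpDl; first by apply: sumr_ge0 => x _; case: ifP.
apply: ler_sum => t t0; rewrite [leRHS](reindex_inj (scalerI t0)) /= big_mkcond /=.
apply: ler_sum => x _; case: (boolP (x \in E)) => [/ES|_] /=; last by case: ifP.
rewrite inE norm2_dot => /eqP xj.
rewrite /hform /= !dotE xj -(Ghom t (x, 1) t0).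
have -> : t *: (x, 1 : F^o) = (t *: x, t : F^o) by congr pair; apply: mulr1.
by rewrite ifT // mulrA mulrC mulrA subrr.
Qed.

End Homogenisation.

(** * Sizes of the level sets of the cone form *)

Section ConeLevels.

Variables (K : realFieldType) (F : finFieldType) (h : nat) (j : F).
Hypotheses (F_odd : odd #|F|) (j_neq0 : j != 0).
Let q : K := #|F|%:R.
Let d := h.*2.
Let V := hspace F d.

(** The slice at height t is given by norm2 x = c + j t^2 and is counted by [norm2_levels]. The
    large deviation at norm 0 occurs only at the roots t of c + j t^2, so the error depends on their
    number. *)
Lemma hform_level (c : F) : exists eps : K, eps ^+ 2 = 1 /\
  \sum_(p : V) (hform j p p == c)%:R
  = q ^+ d + eps * q ^+ h * (\sum_(t : F) (c + j * t ^+ 2 == 0)%:R - 1).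
Proof.
have q0 : q != 0 by rewrite lt0r_neq0 ?card_field_gt0.
have [eps [eps2 N]] := norm2_levels K F_odd h.
exists eps; split=> //; apply: (mulfI q0).
transitivity (\sum_(t : F) (q ^+ d + eps * q ^+ h * (q * (c + j * t ^+ 2 == 0)%:R - 1))).
  rewrite -(pair_bigA _ (fun x (t : F^o) => (hform j (x, t) (x, t) == c)%:R : K)) /=.
  rewrite exchange_big mulr_sumr; apply: eq_bigr => t _; rewrite -N; congr (_ * _).
  apply: eq_bigr => x _; rewrite /hform /= -norm2_dot subr_eq.
  by rewrite -mulrA expr2.
rewrite big_split /= -mulr_sumr sumrB -mulr_sumr !sum_cst_card -/q.
by ring.
Qed.

(** For c = 0 the only root is t = 0, so the error term of [hform_level] vanishes. *)
Lemma hform_level0 : \sum_(p : V) (hform j p p == 0)%:R = #|V|%:R / q.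
Proof.
have [eps [_ ->]] := hform_level 0; rewrite card_hspace.
have -> : \sum_(t : F) (0 + j * t ^+ 2 == 0)%:R = 1 :> K.
  rewrite -[RHS](sum_eq1_cst (0 : F)); apply: eq_bigr => t _.
  by rewrite add0r mulf_eq0 (negPf j_neq0) expf_eq0 mulr1.
by rewrite subrr mulr0 addr0.
Qed.

(** There are at most two roots, so the factor of q^h in [hform_level] lies between -1 and 1. *)
Lemma hform_level_dist (c : F) :
  `|\sum_(p : V) (hform j p p == c)%:R - #|V|%:R / q| <= q ^+ h.
Proof.
have q_gt0 : 0 < q := card_field_gt0 _ _.
have [eps [eps2 ->]] := hform_level c; rewrite card_hspace addrAC subrr add0r.
have eps1 : `|eps| = 1.
  by apply/eqP; rewrite -(@eqrXn2 _ 2) // ?ler01 // real_normK ?num_real // eps2 expr1n.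
have qh0 : 0 <= q ^+ h by rewrite exprn_ge0 // ltW.
rewrite !normrM eps1 mul1r ger0_norm // ler_piMr // ler_norml.
have := square_roots_le K j_neq0 c.
have : 0 <= \sum_(t : F) (c + j * t ^+ 2 == 0)%:R :> K by apply: sumr_ge0.
by move=> ? ?; apply/andP; split; lra.
Qed.

End ConeLevels.

(** * Variances over a subset of the sphere *)

Section Sphere.

Variables (K : realFieldType) (F : finFieldType) (h : nat) (j : F).
Hypotheses (F_odd : odd #|F|) (j_neq0 : j != 0).
Let q : K := #|F|%:R.
Let d := h.*2.
Let V := hspace F d.
Variable E : {set 'rV[F]_d}.
Hypothesis E_sphere : E \subset sphere d j.
Let n : K := #|E|%:R.

Let q_gt0 : 0 < q := card_field_gt0 K F.

Let q_gt1 : 1 < q.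
Proof. by rewrite ltr1n; apply: finNzRing_gt1. Qed.

Lemma dot_sphere x : x \in E -> dot x x = j.
Proof. by move=> /(subsetP E_sphere); rewrite inE norm2_dot => /eqP. Qed.

Lemma norm2_sub_sphere x z : x \in E -> z \in E ->
  norm2 (x - z) = 2 * (j - dot x z).
Proof.
move=> xE zE; rewrite norm2_dot !dotE opprK !dot_sphere // (dotC z).
by ring.
Qed.

Lemma cone_card : \sum_(p : V | hform j p p == 0) 1 = q ^+ d :> K.
Proof.
rewrite -(card_hspace K F d) -(hform_level0 K h F_odd j_neq0) big_mkcond /=.
by apply: eq_bigr => p _; case: (hform j p p == 0).
Qed.

Let isotropic_pairs : K :=
  \sum_(z in E) \sum_(y in E) (norm2 (y - z) == 0)%:R.

Lemma isotropic_pairs_variance :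
  (q - 1) * (isotropic_pairs - n ^+ 2 / q) ^+ 2 <= n ^+ 2 * q ^+ d / q.
Proof.
(* the form pairs (z, 1) with (y, 1) to z.y - j = - ||y - z|| / 2 *)
pose a (y : 'rV[F]_d) : V := (y, 1).
have a0 y : a y != 0 by apply/eqP => -[_ /eqP]; rewrite oner_eq0.
have aa y : y \in E -> hform j (a y) (a y) = 0.
  by move=> yE; rewrite /hform /= dot_sphere // !mulr1 subrr.
have adep y z : dependent (a y) (a z) -> y = z.
  move=> /existsP[s /existsP[t /andP[st0 /eqP[E1 E2]]]].
  have ts : t = - s.
    by apply/eqP; rewrite -addr_eq0 addrC -[s]mulr1 -[t]mulr1; apply/eqP.
  have s0 : s != 0 by move: st0; rewrite ts oppr_eq0 orbb.
  move: E1; rewrite ts scaleNr -scalerBr => /eqP.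
  by rewrite scaler_eq0 (negPf s0) subr_eq0 => /eqP.
have two0 := two_neq0_odd F_odd.
pose f z : K := \sum_(y in E) (hform j (a z) (a y) == 0)%:R.
have fE z : z \in E -> f z = \sum_(y in E) (norm2 (y - z) == 0)%:R.
  move=> zE; apply: eq_bigr => y yE.
  rewrite norm2_sub_sphere // mulf_eq0 (negPf two0) /= /hform /= !mulr1 dotC.
  by rewrite -oppr_eq0 opprB.
have -> : isotropic_pairs - n ^+ 2 / q = \sum_(z in E) (f z - n / q).
  rewrite sumrB (eq_bigr _ fE) sumr_const -mulr_natl -/n; congr (_ - _); ring.
have := @cone_sum_ge K F d j E
  (fun p : V => (\sum_(y in E) (hform j p (a y) == 0)%:R - n / q) ^+ 2) E_sphere.
move=> /(_ (fun p : V => sqr_ge0 _)).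
have hom s p : s != 0 ->
    (\sum_(y in E) (hform j (s *: p) (a y) == 0)%:R - n / q) ^+ 2
    = (\sum_(y in E) (hform j p (a y) == 0)%:R - n / q) ^+ 2 :> K.
  move=> s0; congr ((_ - _) ^+ 2); apply: eq_bigr => y _.
  by rewrite hform_scale_eq0.
move=> /(_ hom) cone.
(* All [a y] are isotropic, so the counts of points orthogonal to one or two of them are exact and e
   = 0 is allowed. By [adep] the dependent pairs lie on the diagonal. *)
have := @variance_bound K _ _ (fun p : V => hform j p p == 0) E
  (fun y p => hform j p (a y) == 0) (fun y z => dependent (a y) (a z))
  q (q ^+ d) 0 (ltW q_gt1) (lexx _) (exprn_ge0 _ (ltW q_gt0)) cone_card.
rewrite !addr0 mulr0 mul0r add0r -/n => var.
have dep_le : \sum_(y in E) \sum_(z in E) (dependent (a y) (a z))%:R <= n.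
  rewrite /n -sumr_const; apply: ler_sum => y yE.
  rewrite -[leRHS](sum_eq1_cst y) [leRHS](bigID (mem E)) /=.
  apply: ler_wpDr; first by apply: sumr_ge0 => *; rewrite mulr1.
  apply: ler_sum => z zE; rewrite mulr1 ler_nat.
  by case: (boolP (dependent _ _)) => // /adep ->; rewrite eqxx.
have {}var : \sum_(p : V | hform j p p == 0)
   (\sum_(y in E) (hform j p (a y) == 0)%:R - n / q) ^+ 2 <= q ^+ d / q * n.
  apply: le_trans (var _ _) _.
  - move=> y yE; rewrite -(card_hspace K F d).
    rewrite (quadric_orth_isotropic two0 (hform_lincomb j) (hformC j)
      (hform_nondegenerate j_neq0) (hform_level0 K h F_odd j_neq0) (a0 y) (aa y yE)).
    by rewrite subrr normr0.
  - move=> y z yE zE nD; rewrite -(card_hspace K F d).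
    by rewrite (quadric_orth2_isotropic two0 (hform_lincomb j) (hformC j)
      (hform_nondegenerate j_neq0) (hform_level0 K h F_odd j_neq0) nD (aa y yE) (aa z zE)).
  - by apply: ler_wpM2l => //; rewrite divr_ge0 ?exprn_ge0 // ltW.
have := sum_sqr_cauchy (mem E) (fun z => f z - n / q); rewrite -/n => CS.
apply: (@le_trans _ _ ((q - 1) * (n * \sum_(z in E) (f z - n / q) ^+ 2))).
  by apply: ler_wpM2l => //; rewrite subr_ge0 ltW.
rewrite mulrCA; have -> : n ^+ 2 * q ^+ d / q = n * (q ^+ d / q * n) by ring.
by apply: ler_wpM2l; rewrite ?ler0n // (le_trans cone var).
Qed.

(* A line through z meets the sphere in at most one more point, unless it is
   isotropic. *)
Lemma chord_dependent_le z y : z \in E -> y \in E :\ z ->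
  \sum_(y' in E :\ z) [exists l : F, y' - z == l *: (y - z)]%:R
  <= 1 + q * (norm2 (y - z) == 0)%:R :> K.
Proof.
move=> zE /setD1P[yz yE]; have [Y0|Y0] := eqVneq (norm2 (y - z)) 0.
  (* An isotropic line is charged with all its q points. *)
  rewrite mulr1; apply: ler_wpDl => //.
  apply: (@le_trans _ _ (#|[set z + l *: (y - z) | l : F]|%:R)); last first.
    by rewrite ler_nat leq_imset_card.
  rewrite -natr_sum ler_nat -[leqRHS]sum1_card big_mkcond [leqRHS]big_mkcond.
  apply: leq_sum => y' _; case: (y' \in E :\ z) => //.
  case: existsP => // -[l /eqP Hl]; rewrite ifT //.
  by apply/imsetP; exists l => //; rewrite -Hl addrC subrK.
rewrite mulr0 addr0 -[leRHS](sum_eq1_cst y) big_mkcond; apply: ler_sum => y' _.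
rewrite mulr1; case: ifP => [/setD1P[y'z y'E]|_]; last by rewrite ler0n.
rewrite ler_nat; case: existsP => // -[l /eqP Hl].
have Ey' : y' = z + l *: (y - z) by rewrite -Hl addrC subrK.
have l0 : l != 0.
  by apply: contraNneq y'z => l0; rewrite Ey' l0 scale0r addr0.
suff /eqP l1 : l - 1 == 0.
  by rewrite Ey' (subr0_eq l1) scale1r addrC subrK eqxx.
have := dot_sphere y'E; rewrite Ey' !dotE !dot_sphere // (dotC y z).
move=> H; rewrite norm2_sub_sphere // mulf_eq0 negb_or (dotC y z) in Y0.
case/andP: Y0 => two0 Y0.
(* The left side is the norm of z + l (y - z) minus j; it factors because y and z lie on the
   sphere. *)
have : (2 * l * (j - dot z y)) * (l - 1) = 0.
  by move/eqP: H; rewrite -subr_eq0 => /eqP H; rewrite -[RHS]H; ring.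
move/eqP; rewrite !mulf_eq0 (negPf two0) (negPf l0) (negPf Y0).
by [].
Qed.

Lemma orthogonal_chords_variance z : z \in E ->
  (q - 1) * \sum_(x in E)
    (\sum_(y in E :\ z) (dot (x - z) (y - z) == 0)%:R - #|E :\ z|%:R / q) ^+ 2
  <= 3 * q ^+ h * #|E :\ z|%:R ^+ 2
     + (q ^+ d / q + q ^+ h) * \sum_(y in E) (1 + q * (norm2 (y - z) == 0)%:R) :> K.
Proof.
move=> zE; set m : K := #|E :\ z|%:R; have two0 := two_neq0_odd F_odd.
(* chosen so that the form pairs (x, 1) with a y to (x - z).(y - z) *)
pose a (y : 'rV[F]_d) : V := (y - z, dot z (y - z) / j).
have a0 y : y != z -> a y != 0.
  by rewrite -subr_eq0; apply: contraNneq => -[-> _].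
have aE x y : hform j (x, 1) (a y) = dot (x - z) (y - z).
  by rewrite /hform /= mulr1 [j * _]mulrC divfK // dotDl dotNl.
(* The first components already put y' on the line through z and y. *)
have adep y y' : y' != z -> y != z -> dependent (a y) (a y') ->
    [exists l : F, y' - z == l *: (y - z)].
  move=> y'z yz /existsP[s /existsP[t /andP[st0 /eqP[E1 _]]]].
  have t0 : t != 0.
    apply: contraTneq st0 => t0; move: E1; rewrite t0 scale0r addr0 => /eqP.
    by rewrite scaler_eq0 subr_eq0 (negPf yz) orbF => /eqP ->; rewrite eqxx.
  apply/existsP; exists (- s / t); apply/eqP; apply: (scalerI t0).
  rewrite scalerA mulrC divfK // scaleNr; apply/eqP.
  by rewrite -addr_eq0 addrC E1.
have := @cone_sum_ge K F d j E
  (fun p : V => (\sum_(y in E :\ z) (hform j p (a y) == 0)%:R - m / q) ^+ 2) E_sphere.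
move=> /(_ (fun p => sqr_ge0 _)).
have hom s (p : V) : s != 0 ->
    (\sum_(y in E :\ z) (hform j (s *: p) (a y) == 0)%:R - m / q) ^+ 2
    = (\sum_(y in E :\ z) (hform j p (a y) == 0)%:R - m / q) ^+ 2 :> K.
  move=> s0; congr ((_ - _) ^+ 2); apply: eq_bigr => y _.
  by rewrite hform_scale_eq0.
move=> /(_ hom) cone.
have am y : y \in E :\ z -> a y != 0 by case/setD1P => /a0.
(* These vectors may be anisotropic, hence the error e = q^h from [hform_level_dist]. *)
have := @variance_bound K _ _ (fun p : V => hform j p p == 0) (E :\ z)
  (fun y p => hform j p (a y) == 0) (fun y y' => dependent (a y) (a y'))
  q (q ^+ d) (q ^+ h) (ltW q_gt1) (exprn_ge0 _ (ltW q_gt0))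
  (exprn_ge0 _ (ltW q_gt0)) cone_card.
rewrite -/m => var.
have -> : \sum_(x in E)
    (\sum_(y in E :\ z) (dot (x - z) (y - z) == 0)%:R - m / q) ^+ 2
  = \sum_(x in E) (\sum_(y in E :\ z) (hform j (x, 1) (a y) == 0)%:R - m / q) ^+ 2.
  by apply: eq_bigr => x _; under eq_bigr => y _ do rewrite -aE.
apply: le_trans cone _; apply: le_trans (var _ _) _.
- move=> y /am ay; rewrite -(card_hspace K F d).
  exact: (quadric_orth_dist two0 (hform_lincomb j) (hformC j)
      (hform_nondegenerate j_neq0) (hform_level_dist K h F_odd j_neq0)).
- move=> y y' _ _ nD; rewrite -(card_hspace K F d) addrC -lerBlDr.
  apply: le_trans (ler_norm _) _.
  exact: (quadric_orth2_dist two0 (hform_lincomb j) (hformC j)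
      (hform_nondegenerate j_neq0) (hform_level_dist K h F_odd j_neq0)).
rewrite lerD2l; apply: ler_wpM2l.
  by rewrite addr_ge0 ?divr_ge0 ?exprn_ge0 // ltW.
(* The right-hand sum runs over all of E, as in [isotropic_pairs]; its term y = z is nonnegative. *)
rewrite [leRHS](bigID (pred1 z)) /= addrC; apply: ler_wpDr.
  apply: sumr_ge0 => y _; rewrite addr_ge0 ?ler01 //.
  by rewrite mulr_ge0 ?ler0n // ltW.
have -> : \sum_(i in E | i != z) (1 + q * (norm2 (i - z) == 0)%:R)
    = \sum_(i in E :\ z) (1 + q * (norm2 (i - z) == 0)%:R) :> K.
  by apply: eq_bigl => y; rewrite !inE andbC.
apply: ler_sum => y yEz; apply: le_trans (chord_dependent_le zE yEz).
apply: ler_sum => y' y'Ez; rewrite ler_nat.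
case/setD1P: yEz => yz _; case/setD1P: y'Ez => y'z _.
by case: (boolP (dependent _ _)) => // /(adep _ _ y'z yz) ->.
Qed.

(** * From parallelograms to corners *)

(** For x, y, z on the sphere, ||x + y - z|| - j = 2 (x - z).(y - z), and 2 is invertible. *)
Lemma corner_parallelogram x y z : x \in E -> y \in E -> z \in E ->
  x + y - z \in E -> dot (x - z) (y - z) = 0.
Proof.
move=> xE yE zE /dot_sphere; rewrite !dotE !opprK !dot_sphere //.
rewrite (dotC y x) (dotC z x) (dotC z y) => H.
apply: (mulfI (two_neq0_odd F_odd)).
by move/eqP: H; rewrite -subr_eq0 mulr0 => /eqP H; rewrite -[RHS]H; ring.
Qed.

(** The fourth point must be k = x + y - z, so each triple counts at most once, and only if it is a
    corner at z. *)
Lemma Lambda4_le_corners : (Lambda4 E)%:R <=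
  \sum_(z in E) \sum_(x in E) \sum_(y in E) (dot (x - z) (y - z) == 0)%:R :> K.
Proof.
rewrite exchange_big /= /Lambda4 natr_sum; apply: ler_sum => x xE.
rewrite [leRHS]exchange_big natr_sum; apply: ler_sum => y yE.
rewrite natr_sum; apply: ler_sum => z zE; rewrite ler_nat sum1_card.
case: (boolP (x + y - z \in E)) => kE.
  rewrite corner_parallelogram // eqxx -[leqRHS](cards1 (x + y - z)).
  apply: subset_leq_card; apply/subsetP => k; rewrite unfold_in => /andP[_].
  by rewrite inE [k == _]eq_sym subr_eq addrC [k + z]addrC.
rewrite eq_card0 // => k; rewrite unfold_in; apply/negP => /andP[kE' /eqP Ek].
by move: kE; rewrite Ek addrC addKr kE'.
Qed.

Lemma Lambda4_le_cube : (Lambda4 E <= #|E| ^ 3)%N.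
Proof.
have -> : (#|E| ^ 3 = \sum_(x in E) \sum_(y in E) \sum_(z in E) 1)%N.
  by rewrite !sum_nat_const muln1 !expnS expn0 muln1.
apply: leq_sum => x _; apply: leq_sum => y _; apply: leq_sum => z _.
rewrite sum1_card -[leqRHS](cards1 (x + y - z)).
apply: subset_leq_card; apply/subsetP => k; rewrite unfold_in => /andP[_].
by rewrite inE [k == _]eq_sym subr_eq addrC [k + z]addrC.
Qed.

(** D counts the isotropic pairs, Y is the total deviation of the corner counts from their expected
    size, and n^2 accounts for the corners with y = z. What remains after these three inequalities
    is real arithmetic. *)
Lemma Lambda4_second_moment : exists D Y : K,
  [/\ (q - 1) * (D - n ^+ 2 / q) ^+ 2 <= n ^+ 2 * q ^+ d / q,
      (Lambda4 E)%:R <= n ^+ 2 + n ^+ 3 / q + Y &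
      (q - 1) * Y ^+ 2 <=
        n ^+ 2 * (3 * q ^+ h * n ^+ 3 + (q ^+ d / q + q ^+ h) * (n ^+ 2 + q * D))].
Proof.
pose f z x : K :=
  \sum_(y in E :\ z) (dot (x - z) (y - z) == 0)%:R - #|E :\ z|%:R / q.
have n0 : 0 <= n by rewrite ler0n.
have mn z : #|E :\ z|%:R <= n by rewrite ler_nat subset_leq_card // subsetDl.
exists isotropic_pairs, (\sum_(z in E) \sum_(x in E) f z x).
split; first exact: isotropic_pairs_variance.
  apply: le_trans Lambda4_le_corners _.
  have -> : n ^+ 2 + n ^+ 3 / q = \sum_(z in E) \sum_(x in E) (1 + n / q).
    by rewrite !sumr_const -[_ *+ #|E|]mulr_natl -[_ *+ #|E|]mulr_natl -/n; ring.
  rewrite -big_split; apply: ler_sum => z zE.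
  rewrite -big_split; apply: ler_sum => x xE /=.
  rewrite (big_setD1 z zE) /= -addrA; apply: lerD; first by rewrite lern1 leq_b1.
  have : #|E :\ z|%:R / q <= n / q by rewrite ler_pM2r ?invr_gt0.
  by rewrite /f; lra.
have CS : (\sum_(z in E) \sum_(x in E) f z x) ^+ 2
    <= n * \sum_(z in E) (n * \sum_(x in E) f z x ^+ 2).
  apply: le_trans (sum_sqr_cauchy (mem E) _) _; apply: ler_wpM2l => //.
  by apply: ler_sum => z _; apply: sum_sqr_cauchy.
have q10 : 0 <= q - 1 by rewrite subr_ge0 ltW.
apply: le_trans (ler_wpM2l q10 CS) _.
rewrite -mulr_sumr mulrA -expr2 mulrCA; apply: ler_wpM2l; first exact: sqr_ge0.
have -> : 3 * q ^+ h * n ^+ 3 + (q ^+ d / q + q ^+ h) * (n ^+ 2 + q * isotropic_pairs)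
  = \sum_(z in E) (3 * q ^+ h * n ^+ 2 + (q ^+ d / q + q ^+ h) *
      \sum_(y in E) (1 + q * (norm2 (y - z) == 0)%:R)).
  rewrite big_split /= sumr_const -[_ *+ #|E|]mulr_natl -mulr_sumr -/n.
  congr (_ + _ * _); first by ring.
  rewrite /isotropic_pairs mulr_sumr.
  have -> : n ^+ 2 = \sum_(z in E) n by rewrite sumr_const -mulr_natl expr2.
  rewrite -big_split; apply: eq_bigr => z _.
  by rewrite big_split /= sumr_const mulr_sumr.
rewrite mulr_sumr; apply: ler_sum => z zE.
apply: le_trans (orthogonal_chords_variance zE) _.
rewrite lerD2r; apply: ler_wpM2l.
  by rewrite mulr_ge0 ?exprn_ge0 // ltW.
by rewrite ler_sqr ?nnegrE ?ler0n.
Qed.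

End Sphere.

(** * Real arithmetic and conclusion *)

(** For d = 2 (h + 1), the letters s, u, b stand for the square roots of q, |E| and q^h, which turns
    fractional powers into monomials. Then q a = q^(d/2) and q a^2 = q^(d-1). *)
Lemma second_moment_arith (K : realFieldType) (s u b D Y L : K) :
  0 <= s -> 0 <= u -> 1 <= b -> 3 <= s ^+ 2 ->
  let q := s ^+ 2 in let n := u ^+ 2 in let a := b ^+ 2 in
  (q - 1) * (D - n ^+ 2 / q) ^+ 2 <= n ^+ 2 * (q * a ^+ 2) ->
  L <= n ^+ 2 + n ^+ 3 / q + Y ->
  (q - 1) * Y ^+ 2 <=
    n ^+ 2 * (3 * (q * a) * n ^+ 3 + (q * a ^+ 2 + q * a) * (n ^+ 2 + q * D)) ->
  L <= 7 * (q^-1 * n ^+ 3 + b * u ^+ 5 + s * b ^+ 3 * u ^+ 3).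
Proof.
move=> s0 u0 b1 q3 q n a HD HL HY.
have n0 : 0 <= n := sqr_ge0 u.
have b0 : 0 <= b by lra.
have a1 : 1 <= a by rewrite /a expr2; nra.
have q0 : 0 < q by rewrite /q; lra.
have na0 : 0 <= n * a by rewrite mulr_ge0 //; lra.
(* A larger D would contradict [HD], because q <= 4 (q - 1). *)
have Dle : D <= n ^+ 2 / q + 2 * (n * a).
  rewrite leNgt; apply/negP => Dgt.
  have X2 : (2 * (n * a)) ^+ 2 < (D - n ^+ 2 / q) ^+ 2.
    by rewrite ltr_sqr ?nnegrE; lra.
  have : (q - 1) * (2 * (n * a)) ^+ 2 < (q - 1) * (D - n ^+ 2 / q) ^+ 2.
    by rewrite ltr_pM2l // /q; lra.
  have -> : (q - 1) * (2 * (n * a)) ^+ 2 = 4 * (q - 1) * (n ^+ 2 * a ^+ 2) by ring.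
  have P0 : 0 <= n ^+ 2 * a ^+ 2 by rewrite mulr_ge0 ?sqr_ge0.
  have : q * (n ^+ 2 * a ^+ 2) <= 4 * (q - 1) * (n ^+ 2 * a ^+ 2).
    by apply: ler_wpM2r => //; rewrite /q; lra.
  by move: HD; rewrite mulrCA; lra.
have qD : q * D <= n ^+ 2 + 2 * q * (n * a).
  have -> : n ^+ 2 + 2 * q * (n * a) = q * (n ^+ 2 / q + 2 * (n * a)).
    by field; rewrite lt0r_neq0.
  by rewrite ler_pM2l.
have aa : a <= a ^+ 2 by rewrite expr2 ler_peMl //; lra.
have a20 : 0 <= a ^+ 2 := sqr_ge0 a.
set P := b * u ^+ 5; set R := b ^+ 2 * u ^+ 4; set T := s * b ^+ 3 * u ^+ 3.
have P0 : 0 <= P by rewrite mulr_ge0 // exprn_ge0.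
have R0 : 0 <= R by rewrite mulr_ge0 // exprn_ge0.
have T0 : 0 <= T by rewrite !mulr_ge0 // exprn_ge0.
(* [HY] and [qD] give (q - 1) Y^2 <= 4 q (P + R + T)^2, and 4 q <= 9 (q - 1). *)
have Yle : Y <= 3 * (P + R + T).
  apply: le_trans (ler_norm _) _.
  rewrite -ler_sqr ?nnegrE ?normr_ge0 //; last by lra.
  rewrite real_normK ?num_real //.
  have q1 : 0 < q - 1 by rewrite /q; lra.
  rewrite -(ler_pM2l q1); apply: le_trans HY _.
  have PRT : P ^+ 2 + R ^+ 2 + T ^+ 2 <= (P + R + T) ^+ 2.
    have : 0 <= P * R + P * T + R * T by rewrite !addr_ge0 ?mulr_ge0.
    by rewrite !expr2; lra.
  have E : n ^+ 2 * (3 * (q * a) * n ^+ 3 + 2 * (q * a ^+ 2) * (2 * n ^+ 2 + 2 * q * (n * a)))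
      = q * (3 * P ^+ 2 + 4 * R ^+ 2 + 4 * T ^+ 2).
    by rewrite /P /R /T /n /a /q; ring.
  apply: (@le_trans _ _ (q * (3 * P ^+ 2 + 4 * R ^+ 2 + 4 * T ^+ 2))).
    rewrite -E; apply: ler_wpM2l; first exact: sqr_ge0.
    rewrite lerD2l.
    apply: (@le_trans _ _ ((q * a ^+ 2 + q * a) * (2 * n ^+ 2 + 2 * q * (n * a)))).
      apply: ler_wpM2l; last by lra.
      by rewrite -mulrDr mulr_ge0 ?ltW //; lra.
    apply: ler_wpM2r.
      have : 0 <= q * (n * a) by rewrite mulr_ge0 // ltW.
      have : 0 <= n ^+ 2 := sqr_ge0 n.
      by lra.
    have : q * a <= q * a ^+ 2 by rewrite ler_pM2l.
    by lra.
  apply: (@le_trans _ _ (q * (4 * (P ^+ 2 + R ^+ 2 + T ^+ 2)))).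
    by apply: ler_wpM2l; [exact: ltW | have := sqr_ge0 P; lra].
  apply: (@le_trans _ _ (q * (4 * (P + R + T) ^+ 2))).
    by apply: ler_wpM2l; [exact: ltW | lra].
  rewrite exprMn mulrA [leRHS]mulrA; apply: ler_wpM2r; first exact: sqr_ge0.
  by rewrite /q; lra.
(* Multiplied by q, this is u w^2 <= u^3 + w^3 with w = s b, times u^3; the larger of u and w
   decides which cube suffices. *)
have RT : R <= q^-1 * n ^+ 3 + T.
  rewrite -(ler_pM2l q0).
  have -> : q * (q^-1 * n ^+ 3 + T) = n ^+ 3 + q * T.
    by field; rewrite lt0r_neq0.
  set w := s * b.
  have w0 : 0 <= w by rewrite mulr_ge0.
  have -> : q * R = u ^+ 3 * (u * w ^+ 2) by rewrite /q /R /w; ring.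
  have -> : n ^+ 3 + q * T = u ^+ 3 * (u ^+ 3 + w ^+ 3).
    by rewrite /q /T /w /n; ring.
  apply: ler_wpM2l; first exact: exprn_ge0.
  have [uw|/ltW wu] := leP u w.
    have : u * w ^+ 2 <= w ^+ 3 by rewrite [w ^+ 3]exprS ler_wpM2r ?sqr_ge0.
    by have := exprn_ge0 3 u0; lra.
  have : u * w ^+ 2 <= u ^+ 3 by rewrite [u ^+ 3]exprS ler_wpM2l // ler_sqr ?nnegrE.
  by have := exprn_ge0 3 w0; lra.
have n2R : n ^+ 2 <= R.
  have -> : n ^+ 2 = 1 * u ^+ 4 by rewrite /n; ring.
  by apply: ler_wpM2r => //; rewrite exprn_ge0.
have n3q : 0 <= q^-1 * n ^+ 3 by rewrite mulr_ge0 ?exprn_ge0 ?invr_ge0 // ltW.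
(* L <= R + n^3 / q + 3 (P + R + T), and [RT] replaces 4 R: the coefficients of n^3 / q, P and T
   become 5, 3 and 7. *)
by move: HL; rewrite -/P -/T [n ^+ 3 / q]mulrC; lra.
Qed.

Lemma powR_half_nat (R : realType) (a x : R) (k : nat) : 0 <= a ->
  x = k%:R / 2 -> a `^ x = Num.sqrt a ^+ k.
Proof.
move=> a0 ->; rewrite mulrC powRrM powR12_sqrt // powR_mulrn //.
exact: sqrtr_ge0.
Qed.

Theorem theorem7 (R : realType) (d : nat) (hd : (4 <= d)%N) (hd_even : ~~ odd d) :
  exists C : R,
    forall (F : finFieldType) (hF : odd #|F|) (j : F) (hj : j != 0)
      (E : {set 'rV[F]_d}) (hE : E \subset sphere d j),
      let q : R := #|F|%:R in
      let N : R := #|E|%:R in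
      (Lambda4 E)%:R <=
        C * Num.min (N ^+ 3)
              (q^-1 * N ^+ 3
               + q `^ ((d%:R - 2) / 4) * N `^ (5 / 2)
               + q `^ ((3 * d%:R - 4) / 4) * N `^ (3 / 2)).
Proof.
(* With d = 2 (h + 1) the exponents (d - 2) / 4 and (3 d - 4) / 4 become h / 2 and (3 h + 1) / 2. *)
have [h dE] : exists h, d = h.+1.*2.
  exists d./2.-1; rewrite prednK; last by case: d hd {hd_even} => [|[]].
  by rewrite -[LHS]odd_double_half (negPf hd_even).
subst d; exists 7 => F hF j hj E hE; cbv zeta.
set q : R := #|F|%:R; set N : R := #|E|%:R.
have q3 : 3 <= q.
  rewrite /q ler_nat; have := finNzRing_gt1 F.
  by case: #|F| hF => [|[|[|]]].
have N0 : 0 <= N by rewrite ler0n.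
have q0 : 0 <= q by lra.
set s := Num.sqrt q; set u := Num.sqrt N.
have s2 : s ^+ 2 = q by rewrite sqr_sqrtr.
have u2 : u ^+ 2 = N by rewrite sqr_sqrtr.
have s0 : 0 <= s := sqrtr_ge0 q.
have s1 : 1 <= s by rewrite -[1]sqrtr1 ler_sqrt; lra.
have -> : q `^ ((h.+1.*2%:R - 2) / 4) = s ^+ h.
  apply: powR_half_nat => //; rewrite -muln2 natrM -[in LHS]addn1 natrD.
  by field.
have -> : q `^ ((3 * h.+1.*2%:R - 4) / 4) = s * (s ^+ h) ^+ 3.
  rewrite -exprM -exprS; apply: powR_half_nat => //.
  rewrite -muln2 natrM -[in LHS]addn1 natrD -[in RHS]addn1 natrD natrM.
  by field.
have -> : N `^ (5 / 2) = u ^+ 5 by apply: powR_half_nat.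
have -> : N `^ (3 / 2) = u ^+ 3 by apply: powR_half_nat.
have b1 : 1 <= s ^+ h by apply: exprn_ege1.
have [D [Y [HD HL HY]]] := Lambda4_second_moment R hF hj hE.
have main := @second_moment_arith R s u (s ^+ h) D Y (Lambda4 E)%:R s0 (sqrtr_ge0 N) b1.
have qh : q ^+ h.+1 = q * (s ^+ h) ^+ 2 by rewrite exprS -s2 -!exprM mulnC.
have qd : q ^+ h.+1.*2 / q = q * (s ^+ h) ^+ 2 ^+ 2.
  have -> : q ^+ h.+1.*2 = (q ^+ h.+1) ^+ 2 by rewrite -exprM muln2.
  by rewrite qh; field; lra.
rewrite -mulrA qd in HD; rewrite qh qd in HY.
rewrite /= s2 u2 in main; move/(_ q3 HD HL HY): main => main.
rewrite minr_pMr //; rewrite le_min main andbT.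
apply: (@le_trans _ _ (N ^+ 3)); last by rewrite ler_peMl ?exprn_ge0 //; lra.
by rewrite -natrX ler_nat Lambda4_le_cube.
Qed.
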